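(* Let $A$ be a two-dimensional curled algebra over $\mathbb F_2$. If $A$ is unital, commutative or associative, then $A$ is endo-commutative.
   Context: An algebra over the two-element field $\mathbb F_2$ is an $\mathbb F_2$-vector space with a bilinear multiplication, not assumed associative, commutative or unital. Unital means having a two-sided identity element. An algebra $A$ is endo-commutative if $x^2y^2=(xy)^2$ for all $x,y\in A$. A two-dimensional algebra is curled if, for every element $x$, the square $x^2$ is a scalar multiple of $x$. *)

(* Defs.v *)
From mathcomp Require Import all_boot all_algebra.

Set Implicit Arguments.
Unset Strict Implicit.
Unset Printing Implicit Defensive.

Import GRing.Theory.
Local Open Scope ring_scope.

(* An algebra over K is a vector space A with a bilinear product
   mul : {bilinear A -> A -> A}; the ring structures of the library are not
   used since they would impose associativity and a unit. *)

Definition unital (T : Type) (mul : T -> T -> T) : Prop :=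
  exists e : T, left_id e mul /\ right_id e mul.

Definition endo_commutative (T : Type) (mul : T -> T -> T) : Prop :=
  forall x y : T, mul (mul x x) (mul y y) = mul (mul x y) (mul x y).

Definition curled (K : fieldType) (A : vectType K) (mul : A -> A -> A) : Prop :=
  forall x : A, exists a : K, mul x x = a *: x.

(* Main.v *)
Require Import Defs.
From mathcomp Require Import all_boot all_algebra.

(** Over the field with two elements, being curled says that every element is
    idempotent or squares to zero, and addition is its own inverse.

    - Unital: if [x^2 = 0] then [(x + e)^2 = e] has to be [0] or [x + e], and
      both force [x = 0].  Hence every element is idempotent, and both sides of
      [x^2 y^2 = (xy)^2] equal [xy].
    - Commutative: in characteristic 2 squaring is additive, and an additive
      map sending each element to [0] or to itself cannot fix one nonzero
      element and kill another ([commutative_idempotent_nil]).  So squaring is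
      globally zero or globally the identity, and both sides agree.

    In the associative case the two kinds of elements may coexist.  If [x] or
    [y] squares to zero, then [(xy)^2 = xyxy] vanishes because it contains a
    factor [n z n] with [n^2 = 0], and such a factor is zero
    ([square_zero_sandwich]).  If both are idempotent, [xy] is idempotent
    ([idempotent_mul]).  Both facts come from [(x + y)^2], which leaves few
    possible values for [xy + yx]. *)

Local Open Scope ring_scope.
Import GRing.Theory.

Lemma addvv_F2 (A : lmodType 'F_2) (x : A) : x + x = 0.
Proof.
have two0 : 1 + 1 = 0 :> 'F_2 by apply/eqP.
by rewrite -[x]scale1r -scalerDl two0 scale0r.
Qed.

Lemma addv_eq0_F2 (A : lmodType 'F_2) (x y : A) : x + y = 0 -> x = y.
Proof. by move=> xy0; rewrite -[LHS]addr0 -(addvv_F2 _ y) addrA xy0 add0r. Qed.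

Lemma curled_F2 (A : vectType 'F_2) (mul : A -> A -> A) :
  curled mul -> forall x, mul x x = 0 \/ mul x x = x.
Proof.
move=> curledA x; have [a ->] := curledA x.
by case: a => [[|[|//]] lt_a]; [left; rewrite -[RHS](scale0r x) | right;
  rewrite -[RHS](scale1r x)]; congr (_ *: _); apply/val_inj.
Qed.

Lemma sqrD (A : vectType 'F_2) (mul : {bilinear A -> A -> A}) (x y : A) :
  mul (x + y) (x + y) = (mul x x + mul y y) + (mul x y + mul y x).
Proof.
by rewrite linearDl !linearDr [mul y x + _]addrC addrACA.
Qed.

Lemma unital_sqr_id (A : vectType 'F_2) (mul : {bilinear A -> A -> A}) :
  curled mul -> unital mul -> forall x, mul x x = x.
Proof.
move=> /curled_F2 sqP [e [mul1x mulx1]] x.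
have [x2_0|//] := sqP x; rewrite x2_0.
have := sqP (x + e).
rewrite sqrD x2_0 mul1x mulx1 mul1x addvv_F2 add0r addr0.
case=> [e0|exe]; first by rewrite -(mul1x x) e0 linear0l.
by apply: (addIr e); rewrite add0r.
Qed.

(** The square of the sum [u + v] is [u], which must be [0] or [u + v]. *)
Lemma commutative_idempotent_nil (A : vectType 'F_2)
    (mul : {bilinear A -> A -> A}) (u v : A) :
    curled mul -> commutative mul -> mul u u = u -> mul v v = 0 ->
  u = 0 \/ v = 0.
Proof.
move=> /curled_F2 sqP mulC u2 v2; have := sqP (u + v).
rewrite sqrD u2 v2 (mulC v) addvv_F2 !addr0.
case=> [|uuv]; first by left.
by right; apply: (addrI u); rewrite addr0.
Qed.

Lemma commutative_endo_commutative (A : vectType 'F_2)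
    (mul : {bilinear A -> A -> A}) :
  curled mul -> commutative mul -> endo_commutative mul.
Proof.
move=> curledA mulC x y; have sqP := curled_F2 _ _ curledA.
have idnil := commutative_idempotent_nil _ _ _ _ curledA mulC.
have [xy2|xy2] := sqP (mul x y); rewrite xy2.
  have [->|x2] := sqP x; first by rewrite linear0l.
  have [->|y2] := sqP y; first by rewrite linear0r.
  by rewrite x2 y2; have [->|//] := idnil _ _ x2 xy2; rewrite linear0l.
have [x2|->] := sqP x.
  by rewrite x2 linear0l; have [->|->] := idnil _ _ xy2 x2; rewrite ?linear0l.
have [y2|->//] := sqP y.
by rewrite y2 linear0r; have [->|->] := idnil _ _ xy2 y2; rewrite ?linear0r.
Qed.

(** Write [x^2 = a x] and [(n + x)^2 = d (n + x)].  Multiplying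
    [n x + x n = a x + d (n + x)] by [n] on the left and on the right gives
    [n x n = (a + d) n x = (a + d) x n].  Either [a + d = 0], or
    [n x n = x n], and then one more factor [n] on the left kills it. *)
Lemma square_zero_sandwich (A : vectType 'F_2)
    (mul : {bilinear A -> A -> A}) (n x : A) :
    curled mul -> associative mul -> mul n n = 0 -> mul (mul n x) n = 0.
Proof.
move=> /curled_F2 sqP mulA n2.
have nnx : mul n (mul n x) = 0 by rewrite mulA n2 linear0l.
have xnn : mul (mul x n) n = 0 by rewrite -mulA n2 linear0r.
have kill : mul (mul n x) n = mul x n -> mul (mul n x) n = 0.
  by move=> nxn; rewrite -mulA -nxn -mulA mulA n2 linear0l.
have := sqP (n + x); rewrite sqrD n2 add0r.
case: (sqP x) => -> [] E.
- move: (congr1 (mul n) E).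
  by rewrite add0r linearDr nnx add0r linear0r mulA.
- apply: kill; move: (congr1 (mul^~ n) E) => /=.
  by rewrite add0r !linearDl xnn n2 add0r addr0.
- apply: kill; move: (congr1 (mul^~ n) E) => /=.
  by rewrite !linearDl xnn addr0 linear0l => /addv_eq0_F2.
- move: (congr1 (mul n) E).
  rewrite !linearDr nnx n2 !add0r mulA => {}E.
  by apply: (addrI (mul n x)); rewrite addr0.
Qed.

(** The square of [x + y] makes [xy + yx] equal to [x + y] or [0].  In the
    first case multiply by [x] on the left and [y] on the right; in the second
    [x] and [y] commute. *)
Lemma idempotent_mul (A : vectType 'F_2)
    (mul : {bilinear A -> A -> A}) (x y : A) :
    curled mul -> associative mul -> mul x x = x -> mul y y = y ->
  mul (mul x y) (mul x y) = mul x y.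
Proof.
move=> /curled_F2 sqP mulA x2 y2.
have := sqP (x + y); rewrite sqrD x2 y2 => -[/addv_eq0_F2 E|E].
  have := congr1 (fun z => mul (mul x z) y) E => /=.
  have xyy : mul (mul x y) y = mul x y by rewrite -mulA y2.
  rewrite !linearDr !linearDl !mulA !x2 !xyy addvv_F2 => /esym.
  by move=> /addv_eq0_F2 <-.
have /addv_eq0_F2 C : mul x y + mul y x = 0.
  by apply: (addrI (x + y)); rewrite addr0.
by rewrite {2}C mulA -(mulA x) y2 -mulA -C mulA x2.
Qed.

Lemma associative_endo_commutative (A : vectType 'F_2)
    (mul : {bilinear A -> A -> A}) :
  curled mul -> associative mul -> endo_commutative mul.
Proof.
move=> curledA mulA x y; have sqP := curled_F2 _ _ curledA.
have [x2|x2] := sqP x.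
  by rewrite x2 linear0l mulA square_zero_sandwich // linear0l.
have [y2|y2] := sqP y.
  by rewrite y2 linear0r -mulA (mulA y) square_zero_sandwich // linear0r.
by rewrite x2 y2 idempotent_mul.
Qed.

Theorem corollary2 (A : vectType 'F_2) (mul : {bilinear A -> A -> A})
    (dimA : \dim {:A} = 2%N) (curledA : curled mul) :
  unital mul \/ commutative mul \/ associative mul -> endo_commutative mul.
Proof.
case=> [unitalA x y|[mulC|mulA]].
- by rewrite !(unital_sqr_id _ _ curledA unitalA).
- exact: commutative_endo_commutative.
- exact: associative_endo_commutative.
Qed.
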